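(* In the unconstrained fluid model, the unique symmetric Nash equilibrium arrival density is a step function with three steps: $$f(t)=\begin{cases}\dfrac{\alpha+\beta_1}{\alpha}\dfrac{\mu}{\Lambda}, & -\dfrac{\beta_2\Lambda}{(\beta_1+\beta_2)\mu}\le t\le -\dfrac{\beta_1}{\alpha+\beta_1}\dfrac{\beta_2\Lambda}{(\beta_1+\beta_2)\mu},\\[2mm] \dfrac{\alpha+\beta_1}{\alpha+\beta_2}\dfrac{\mu}{\Lambda}, & -\dfrac{\beta_1}{\alpha+\beta_1}\dfrac{\beta_2\Lambda}{(\beta_1+\beta_2)\mu}\le t\le 0,\\[2mm] \dfrac{\alpha}{\alpha+\beta_2}\dfrac{\mu}{\Lambda}, & 0\le t\le \dfrac{\beta_1\Lambda}{(\beta_1+\beta_2)\mu},\end{cases}$$ (and $f=0$ elsewhere). The corresponding social cost is $\dfrac{\beta_1\beta_2\Lambda^2}{(\beta_1+\beta_2)\mu}$.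
   Context: Fluid model. A continuum of infinitesimal customers (drops) of total deterministic volume $\Lambda>0$ each choose an arrival time. The server works first-come-first-served and serves volume at rate $\mu>0$ whenever there is a queue; a drop finding volume $\eta$ in the queue upon arrival waits exactly $\eta/\mu$. A drop arriving at $t_1$ and served at $t_2\ge t_1$ pays $\beta_1\max(-t_1,0)$ (earliness) $+\ \alpha(t_2-t_1)$ (waiting) $+\ \beta_2\max(t_2,0)$ (tardiness), with $\alpha,\beta_1,\beta_2>0$. $F(t)$ denotes the proportion of drops that arrived prior to time $t$, and its density is $f$ (densities are understood up to values at finitely many points). In the unconstrained model, any arrival time in $\mathbb{R}$ is allowed. A symmetric Nash equilibrium is an arrival distribution $F$ such that, when the drops arrive according to $F$, no drop can lower its cost by changing its arrival time (the cost is constant on the support of $F$ and nowhere smaller). The social cost is the total cost of all drops. *)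

(* Defs.v *)
From HB Require Import structures.
From mathcomp Require Import all_boot all_order all_algebra.
From mathcomp Require Import all_classical all_reals all_analysis.

Set Implicit Arguments.
Unset Strict Implicit.
Unset Printing Implicit Defensive.

Import Order.TTheory GRing.Theory Num.Theory.
Import numFieldNormedType.Exports.

Local Open Scope classical_set_scope.
Local Open Scope ring_scope.

Section ArrivalDistribution.
Context {R : realType}.
Implicit Types (P : probability (measurableTypeR R) R) (f : R -> R).

(* Two drops never arrive simultaneously, so first-come-first-served needs no
   tie-breaking rule.  Every distribution that has a density is atomless. *)
Definition atomless P : Prop := forall t : R, P [set t] = 0%E.

(* The proportion of drops that arrived strictly before t. *)
Definition arrived P (t : R) : R := fine (P `]-oo, t[%classic).

Definition density_of P f : Prop :=
  [/\ measurable_fun setT f, forall t, 0 <= f t &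
      forall A : set R, measurable A ->
        P A = (\int[lebesgue_measure]_(t in A) (f t)%:E)%E].

Definition arrival_support P : set R :=
  [set t | forall e : R, 0 < e -> (0 < P (ball t e))%E].

Definition piecewise_continuous f : Prop :=
  finite_set [set t | ~ {for t, continuous f}].

End ArrivalDistribution.

Section FluidQueue.
Context {R : realType}.
Variables (mu Lambda : R) (P : probability (measurableTypeR R) R).

(* The volume that has left the queue before t, when q is the volume present. *)
Definition served (q : R -> R) (t : R) : R := Lambda * arrived P t - q t.

(* q t is the volume in the queue at time t.  Only drops that have arrived can
   be queueing or have been served; the server works at rate at most mu, and at
   rate exactly mu as long as there is a queue.  For an atomless P these
   conditions determine q uniquely: q <= Lambda * arrived P (that is, served
   is nonnegative) rules out solutions with a queue already present at -oo. *)
Definition fluid_queue (q : R -> R) : Prop :=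
  [/\ forall t, 0 <= q t <= Lambda * arrived P t,
      forall s t, s <= t ->
        0 <= served q t - served q s <= mu * (t - s) &
      forall s t, s <= t -> (forall u, s <= u <= t -> 0 < q u) ->
        served q t - served q s = mu * (t - s)].

End FluidQueue.

Section Equilibrium.
Context {R : realType}.
Variables (alpha beta1 beta2 mu Lambda : R).
Implicit Type P : probability (measurableTypeR R) R.

Definition drop_cost (t1 t2 : R) : R :=
  beta1 * Num.max (- t1) 0 + alpha * (t2 - t1) + beta2 * Num.max t2 0.

Definition arrival_cost (q : R -> R) (t : R) : R := drop_cost t (t + q t / mu).

(* A drop is infinitesimal, so its deviation does not affect q. *)
Definition nash_equilibrium P (q : R -> R) : Prop :=
  [/\ atomless P, fluid_queue mu Lambda P q &
      exists c : R,
        (forall t, arrival_support P t -> arrival_cost q t = c) /\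
        (forall t, c <= arrival_cost q t)].

Definition social_cost P (q : R -> R) : \bar R :=
  (Lambda%:E * \int[P]_t (arrival_cost q t)%:E)%E.

Definition first_arrival : R := - (beta2 * Lambda / ((beta1 + beta2) * mu)).

(* The drop arriving at this time is served at time 0. *)
Definition switch_time : R :=
  - (beta1 / (alpha + beta1) * (beta2 * Lambda / ((beta1 + beta2) * mu))).

Definition last_arrival : R := beta1 * Lambda / ((beta1 + beta2) * mu).

(* At the common endpoint of two steps the value of the earlier step is used. *)
Definition step_density (t : R) : R :=
  if first_arrival <= t <= switch_time then
    (alpha + beta1) / alpha * (mu / Lambda)
  else if switch_time <= t <= 0 then
    (alpha + beta1) / (alpha + beta2) * (mu / Lambda)
  else if 0 <= t <= last_arrival then
    alpha / (alpha + beta2) * (mu / Lambda)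
  else 0.

End Equilibrium.

(* Main.v *)
Require Import Defs.
From HB Require Import structures.
From mathcomp Require Import all_boot all_order all_algebra.
From mathcomp Require Import all_classical all_reals all_analysis.
From mathcomp Require Import measurable_realfun.
From mathcomp Require Import ring lra.

Set Implicit Arguments.
Unset Strict Implicit.
Unset Printing Implicit Defensive.

Import Order.TTheory GRing.Theory Num.Theory.
Import numFieldNormedType.Exports.

Local Open Scope classical_set_scope.
Local Open Scope ring_scope.

(** Call idle cost at t the cost [drop_cost t t] of a drop that arrives at t and
   finds no queue; it is [beta1 * (- t)] before time 0 and [beta2 * t] after.
   Let c be the cost of an equilibrium, which is positive because an atomless
   distribution has a support point other than 0.  The idle cost is below c
   exactly on the open interval from a = - c / beta1 to b = c / beta2.
   - Outside [a, b] waiting can only add to an idle cost that exceeds c, so no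
     drop arrives there.
   - Inside, an empty queue would allow a cost below c, so there is a queue and
     the server works at rate mu: the volume served by time t is mu * (t - a).
   - Hence the cost is c on all of [a, b].  Otherwise take t in [a, b] with cost
     above c, and let s be the last time before t at which the cost is c.
     The cost exceeds c between s and t, so nobody arrives then; as the server is
     busy, drops arriving at s and at t leave simultaneously, and the later one
     pays less than c.
   - At a and at b the cost equals the idle cost, so the queue is empty there;
     therefore the whole volume is served during [a, b], and
     Lambda = mu * (b - a) determines c.
   This is [nash_structure]: in every equilibrium the served volume and the cost
   are the same explicit functions of time, the cost being the maximum of c and
   the idle cost.  As the cost is strictly increasing in the queue length, the
   queue and then the distribution function are determined as well.

   The measure with density [step_density] has a piecewise linear distribution
   function, and the corresponding queue is computed on each linear piece
   ([step_queueE]); its cost is again the maximum of c and the idle cost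
   ([step_queue_cost]).  This makes it an equilibrium ([step_nash]) and
   identifies it with every other one ([nash_density]).  The social cost is
   Lambda * c, since the cost is c almost surely. *)

(** * Arrival distributions *)

Lemma in_ball {R : realType} (t e x : R) : ball t e x = (t - e < x < t + e) :> Prop.
Proof. by rewrite ball_itv /= in_itv. Qed.

Section Arrivals.
Context {R : realType} (P : probability (measurableTypeR R) R).

(** The complement of the support is covered by the countably many null intervals
   with rational endpoints. *)
Lemma complement_support_negligible : P.-negligible (~` arrival_support P).
Proof.
(* The n-th pair of rationals gives its interval if that interval is null. *)
pose F (n : nat) : set R :=
  if @unpickle (rat * rat)%type n is Some (p, r) then
    if P `]ratr p, ratr r[%classic == 0%E then `]ratr p, ratr r[%classic else set0
  else set0.
apply: (@negligibleS _ _ _ P (\bigcup_n F n)); last first.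
  apply: negligible_bigcup => n; rewrite /F.
  case: unpickle => [[p r]|]; last exact: negligible_set0.
  case: eqP => [P0|_]; last exact: negligible_set0.
  by apply/negligibleP.
move=> t /= /existsNP[e /not_implyP[e0 /negP]]; rewrite -leNgt => Pe.
have [p /itvP pt] : exists p : rat, ratr p \in `](t - e), t[.
  by apply: rat_in_itvoo; rewrite ltrBlDr ltrDl.
have [r /itvP tr] : exists r : rat, ratr r \in `]t, (t + e)[.
  by apply: rat_in_itvoo; rewrite ltrDl.
exists (pickle (p, r)); first exact: I.
rewrite /F pickleK ifT; first by rewrite /= in_itv /= pt tr.
rewrite eq_le measure_ge0 andbT (le_trans _ Pe)// le_measure ?inE//.
  by rewrite ball_itv.
move=> x /=; rewrite in_ball in_itv /= => /andP[px xr].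
by rewrite (lt_trans _ px) ?pt// (lt_trans xr) ?tr.
Qed.

Lemma null_off_support (A : set R) : measurable A ->
  (forall t, A t -> ~ arrival_support P t) -> P A = 0%E.
Proof.
move=> mA AS; apply/(@negligibleP _ _ _ P) => //.
exact: negligibleS complement_support_negligible.
Qed.

(** An atomless distribution is not concentrated at a single point. *)
Lemma support_neq_exists (atP : atomless P) (x : R) :
  exists2 t, arrival_support P t & t != x.
Proof.
apply: contrapT => /forall2NP nS.
have : P [set x] = 1%E.
  rewrite -[[set x]]setCK probability_setC; last exact: measurableC.
  rewrite null_off_support ?sube0//; first exact: measurableC.
  move=> t /= tx St; case: (nS t) => // /negP; rewrite negbK => /eqP; exact: tx.
by rewrite atP => /esym/eqP; rewrite onee_eq0.
Qed.

Lemma arrivedB s t : s <= t -> arrived P t - arrived P s = fine (P `[s, t[%classic).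
Proof.
move=> st; rewrite /arrived.
have -> : `]-oo, t[%classic = `]-oo, s[%classic `|` `[s, t[%classic :> set R.
  by rewrite -itv_bndbnd_setU// bnd_simp.
rewrite measureU//; last first.
  apply/seteqP; split => // x []/=; rewrite !in_itv/= => xs.
  by case/andP => /(lt_le_trans xs); rewrite ltxx.
by rewrite fineD ?fin_num_measure// addrAC subrr add0r.
Qed.

Lemma arrived_nd s t : s <= t -> arrived P s <= arrived P t.
Proof. by move=> st; rewrite -subr_ge0 arrivedB// fine_ge0. Qed.

Lemma arrived_off_support (atP : atomless P) s t : s <= t ->
  (forall u, s < u < t -> ~ arrival_support P u) -> arrived P s = arrived P t.
Proof.
move=> st nS; apply/esym/eqP; rewrite -subr_eq0 arrivedB//; apply/eqP.
suff -> : P `[s, t[%classic = 0%E by [].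
apply/eqP; rewrite eq_le measure_ge0 andbT.
apply: (@le_trans _ _ (P ([set s] `|` `]s, t[%classic))).
  apply: le_measure; rewrite ?inE//; first exact: measurableU.
  move=> x /=; rewrite !in_itv/= le_eqVlt => /andP[/orP[/eqP ->|sx] xt]; [by left|right].
  by rewrite sx xt.
apply: (le_trans (measureU2 _ _ _)) => //.
by rewrite [X in (X + _)%E]atP [X in (_ + X)%E]null_off_support ?adde0.
Qed.

Lemma arrived_eq0 (t : R) : (forall u, u < t -> ~ arrival_support P u) -> arrived P t = 0.
Proof. by move=> nS; rewrite /arrived null_off_support// => u /=; rewrite in_itv; exact: nS. Qed.

Lemma arrived_eq1 (atP : atomless P) (t : R) :
  (forall u, t < u -> ~ arrival_support P u) -> arrived P t = 1.
Proof.
move=> nS; have <- : fine (P (`]-oo, t[%classic `|` ([set t] `|` `]t, +oo[%classic))) = 1.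
  rewrite (_ : _ `|` _ = setT) ?probability_setT//; apply/seteqP; split => // x _ /=.
  by rewrite !in_itv/= andbT; case: (ltgtP x t); [left|right; right|right; left].
rewrite /arrived; congr fine; apply/esym.
have m1 : measurable ([set t] `|` `]t, +oo[%classic : set (measurableTypeR R)).
  exact: measurableU.
apply/eqP; rewrite eq_le; apply/andP; split; last first.
  apply: le_measure; rewrite ?inE; [by []|exact: measurableU|by move=> x; left].
apply: (le_trans (measureU2 _ _ _)) => //.
rewrite -[leRHS]adde0 leeD2l//.
apply: (le_trans (measureU2 _ _ _)) => //.
rewrite [X in (X + _)%E]atP [X in (_ + X)%E]null_off_support ?adde0// => u /=.
by rewrite in_itv/= andbT; exact: nS.
Qed.

(** The balls around t of radius 1 / (n + 1) shrink to the null set [set t]. *)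
Lemma arrived_continuous : atomless P -> continuous (arrived P).
Proof.
move=> atP t.
pose B n : set R := ball t n.+1%:R^-1.
have mB n : measurable (B n : set (measurableTypeR R)) by rewrite /B ball_itv.
have capB : \bigcap_n B n = [set t].
  apply/seteqP; split => [x xB|x -> n _]; last exact: ballxx.
  apply: contrapT => /eqP; rewrite eq_sym -subr_eq0 -normr_gt0 => xt.
  have /(_ (Num.bound (`|t - x|^-1)) I) := xB; rewrite /B in_ball -ltr_distlC.
  apply/negP; rewrite -leNgt -[leRHS]invrK lef_pV2 ?posrE ?invr_gt0//.
  apply/ltW/(lt_trans (archi_boundP _)); first by rewrite invr_ge0.
  by rewrite ltr_nat.
have cvB : P (B n) @[n --> \oo] --> (0%E : \bar R).
  rewrite -(atP t) -capB; apply: nonincreasing_cvg_mu => //.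
  - by rewrite -ge0_fin_numE// fin_num_measure.
  - by apply: bigcap_measurable.
  - move=> m n mn; apply/subsetPset; apply: le_ball.
    by rewrite lef_pV2 ?posrE// ler_nat ltnS.
apply/cvgrPdist_lt => e e0.
have /fine_cvg/cvgr0_norm_lt/(_ e e0)[N _ /(_ N (leqnn N)) /= PN] := cvB.
have {}PN : fine (P (B N)) < e by rewrite (le_lt_trans (ler_norm _)).
near=> s.
have sB : B N s.
  by near: s; apply/nbhs_ballP; exists N.+1%:R^-1 => //=; rewrite invr_gt0.
apply: le_lt_trans PN.
have key x y : x <= y -> B N x -> B N y -> arrived P y - arrived P x <= fine (P (B N)).
  move=> xy Bx By; rewrite arrivedB// fine_le ?fin_num_measure// le_measure ?inE//.
  move=> z /=; rewrite in_itv /= => /andP[xz zy].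
  move: Bx By; rewrite /B !in_ball => /andP[h1 _] /andP[_ h2].
  by rewrite (lt_le_trans h1 xz) (lt_trans zy h2).
have tB : B N t by exact: ballxx.
case: (leP s t) => st.
  by rewrite ger0_norm ?subr_ge0 ?arrived_nd// key.
have {}st := ltW st.
by rewrite ler0_norm ?subr_le0 ?arrived_nd// opprB key.
Unshelve. all: by end_near. Qed.

End Arrivals.

(** The open rays to the left generate the Borel sets and are closed under
   intersection. *)
Lemma arrived_determines {R : realType} (P Q : probability (measurableTypeR R) R) :
  arrived P =1 arrived Q -> forall A : set R, measurable A -> P A = Q A.
Proof.
move=> PQ A.
refine (@measure_unique _ R (measurableTypeR R) (@RGenInftyO.G R)
  (fun n => `]-oo, n%:R[%classic) _ _ _ _ P Q _ _ A).
- exact: RGenInftyO.measurableE.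
- move=> _ _ [x ->] [y ->]; exists (Num.min x y).
  by apply/seteqP; split => z /=; rewrite !in_itv/= lt_min; [case=> -> ->|case/andP].
- by move=> n; exists n%:R.
- apply/seteqP; split => // x _; exists (Num.bound `|x : R|) => //=.
  by rewrite in_itv /= (le_lt_trans (ler_norm _))// archi_boundP.
- move=> _ [x ->].
  have : (arrived P x)%:E = (arrived Q x)%:E by rewrite PQ.
  by rewrite /arrived !fineK ?fin_num_measure.
- by move=> n; rewrite -ge0_fin_numE// fin_num_measure.
Qed.

(** * Densities *)

(** The point of the interval [x, y] nearest to t, for [x <= y]. *)
Definition clamp {R : realType} (x y t : R) : R := Num.max x (Num.min t y).

Section Clamp.
Context {R : realType}.
Implicit Types x y t : R.

Lemma clamp_le x y t : x <= y -> t <= x -> clamp x y t = x.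
Proof. by move=> xy tx; rewrite /clamp min_l ?max_l// (le_trans tx). Qed.

Lemma clamp_ge x y t : x <= y -> y <= t -> clamp x y t = y.
Proof. by move=> xy yt; rewrite /clamp min_r ?max_r. Qed.

Lemma clamp_mid x y t : x <= t <= y -> clamp x y t = t.
Proof. by move=> /andP[xt ty]; rewrite /clamp min_l ?max_r. Qed.

Lemma clamp_lipschitz x y s t : x <= y -> s <= t -> 0 <= clamp x y t - clamp x y s <= t - s.
Proof.
move=> xy st; rewrite /clamp /Num.max /Num.min.
by do ![case: ifPn]; rewrite -?leNgt; lra.
Qed.

Lemma lebesgue_measure_itv_clamp b x y t : x <= y ->
  lebesgue_measure ([set` Interval (BSide b x) (BRight y)] `&` `]-oo, t[ : set R)
    = (clamp x y t - x)%:E.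
Proof.
move=> xy; case: (leP t x) => [tx|xt].
  rewrite clamp_le// subrr (_ : _ `&` _ = set0) ?measure0//.
  apply/seteqP; split => // z [] /=; rewrite !itv_boundlr /= => /andP[].
  by case: b; rewrite !bnd_simp => xz _ zt; have : False by lra.
case: (leP t y) => [ty|yt].
  rewrite clamp_mid ?(ltW xt)// (_ : _ `&` _ = [set` Interval (BSide b x) (BLeft t)]).
    by rewrite lebesgue_measure_itv/= lte_fin xt EFinB.
  apply/seteqP; split => z /=; rewrite !itv_boundlr /= !bnd_simp.
    by case=> /andP[-> _] ->.
  by move=> /andP[-> zt]; rewrite zt (le_trans (ltW zt)).
rewrite clamp_ge ?(ltW yt)// (_ : _ `&` _ = [set` Interval (BSide b x) (BRight y)]).
  rewrite lebesgue_measure_itv/= lte_fin; case: ltP => [_|yx]; first by rewrite EFinB.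
  by rewrite (_ : y - x = 0)//; lra.
apply/seteqP; split => z /=; rewrite !itv_boundlr /= !bnd_simp; first by case.
by move=> /andP[-> zy]; rewrite zy (le_lt_trans zy).
Qed.

End Clamp.

Lemma probability_of_density {R : realType} (f : R -> R) :
  measurable_fun setT f -> (forall t, 0 <= f t) ->
  (\int[lebesgue_measure]_t (f t)%:E = 1)%E ->
  exists P : probability (measurableTypeR R) R, density_of P f.
Proof.
move=> mf f0 f1.
pose m (A : set (measurableTypeR R)) := (\int[lebesgue_measure]_(t in A) (f t)%:E)%E.
have m0 : m set0 = 0%E by rewrite /m integral_set0.
have m_ge0 A : (0 <= m A)%E by apply: integral_ge0 => x _; rewrite lee_fin.
have m_add : semi_sigma_additive m.
  by apply: semi_sigma_additive_nng_induced => //; exact/measurable_EFinP.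
pose mi := isMeasure.Build _ _ _ m m0 m_ge0 m_add.
pose mm : {measure set (measurableTypeR R) -> \bar R} := HB.pack m mi.
have mT : mm setT = 1%E by [].
pose pi := Measure_isProbability.Build _ _ _ mm mT.
pose pm : probability (measurableTypeR R) R := HB.pack m mm pi.
by exists pm; split.
Qed.

Lemma density_atomless {R : realType} (P : probability (measurableTypeR R) R) f :
  density_of P f -> atomless P.
Proof.
move=> [mf f0 Pf] t; rewrite Pf//; apply: null_set_integral => //.
  by apply/measurable_EFinP; exact: measurable_funTS.
exact: lebesgue_measure_set1.
Qed.

Lemma density_neq0_near_support {R : realType} (P : probability (measurableTypeR R) R) f t :
  density_of P f -> arrival_support P t -> forall e, 0 < e -> exists2 u, ball t e u & f u != 0.
Proof.
move=> [mf f0 Pf] St e e0; apply: contrapT => /forall2NP nf.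
have := St e e0; rewrite Pf; last by rewrite ball_itv.
rewrite integral0_eq ?ltxx// => u tu.
by case: (nf u) => // /negP; rewrite negbK => /eqP ->.
Qed.

Lemma density_ae_unique {R : realType} (P : probability (measurableTypeR R) R) f g :
  density_of P f -> density_of P g -> f = g %[ae (@lebesgue_measure R)].
Proof.
move=> [mf f0 Pf] [mg g0 Pg].
have If : (@lebesgue_measure R).-integrable setT (EFin \o f).
  apply/integrableP; split; first exact/measurable_EFinP.
  under eq_integral => x _ do rewrite /= ger0_norm//.
  by rewrite -Pf// probability_setT ltry.
have := @integral_ae_eq _ _ _ (@lebesgue_measure R) setT measurableT (EFin \o g) (EFin \o f) If.
have mg' : measurable_fun setT (EFin \o g) by exact/measurable_EFinP.
move=> /(_ mg') H.
have {}H : ae_eq (@lebesgue_measure R) setT (EFin \o f) (EFin \o g).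
  by apply: H => E _ mE; rewrite -Pf// -Pg.
by apply: filterS H => x /(_ I) /= [].
Qed.

Lemma ae_eq_at_continuity {R : realType} (f g : R -> R) (t : R) :
  f = g %[ae (@lebesgue_measure R)] ->
  {for t, continuous f} -> {for t, continuous g} -> f t = g t.
Proof.
move=> fg cf cg; apply: contrapT => /eqP; rewrite -subr_eq0 => ne.
have cfg : {for t, continuous (fun u => f u - g u)} by apply: cvgB.
have [e /= e0 ball_ne] : nbhs t [set u | f u - g u != 0].
  exact: (@cvgr_neq0 _ _ _ _ _ (fun u => f u - g u) _ cfg ne).
have /negligibleP : (@lebesgue_measure R).-negligible `]t - e, t + e[%classic.
  apply: negligibleS fg => u /= tu fgu.
  rewrite in_itv /= -ltr_distlC in tu.
  by have /= := ball_ne _ tu; rewrite (fgu I) subrr eqxx.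
move=> /(_ (measurable_itv _)) null.
have : @lebesgue_measure R `]t - e, t + e[%classic = 0%E := null.
rewrite lebesgue_measure_itv /= lte_fin ifT; last by lra.
by rewrite -EFinB => -[]; lra.
Qed.

Lemma continuous_indic_itv {R : realType} (b : bool) (x y t : R) : t != x -> t != y ->
  {for t, continuous (\1_[set` Interval (BSide b x) (BRight y)] : R -> R)}.
Proof.
move=> tx ty.
suff : \forall u \near t, (\1_[set` Interval (BSide b x) (BRight y)] u : R) =
    \1_[set` Interval (BSide b x) (BRight y)] t by exact: cvg_near_cst.
have same z : t != z -> \forall u \near t, (u < z) = (t < z) /\ (z < u) = (z < t).
  case: (ltgtP t z) => // tz _.
    near=> u; have uz : u < z by near: u; exact: lt_nbhsl.
    by rewrite uz; split => //; apply/negbTE; rewrite -leNgt ltW.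
  near=> u; have uz : z < u by near: u; exact: lt_nbhsr.
  by rewrite uz; split => //; apply/negbTE; rewrite -leNgt ltW.
near=> u; rewrite !indicE !mem_setE !itv_boundlr /= !bnd_simp.
have [xu1 xu2] : (u < x) = (t < x) /\ (x < u) = (x < t) by near: u; exact: same.
have [yu1 yu2] : (u < y) = (t < y) /\ (y < u) = (y < t) by near: u; exact: same.
by rewrite 2!(leNgt _ y) yu2; case: b; rewrite !bnd_simp ?(leNgt x) ?xu1 ?xu2.
Unshelve. all: by end_near. Qed.

(** * Costs *)

Section Equilibria.
Context {R : realType} (alpha beta1 beta2 mu Lambda : R).
Hypotheses (halpha : 0 < alpha) (hbeta1 : 0 < beta1) (hbeta2 : 0 < beta2)
  (hmu : 0 < mu) (hLambda : 0 < Lambda).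

Local Notation cost := (drop_cost alpha beta1 beta2).
Local Notation acost := (arrival_cost alpha beta1 beta2 mu).
Local Notation t_first := (first_arrival beta1 beta2 mu Lambda).
Local Notation t_last := (last_arrival beta1 beta2 mu Lambda).
Local Notation t_switch := (switch_time alpha beta1 beta2 mu Lambda).
Local Notation step := (step_density alpha beta1 beta2 mu Lambda).
Local Notation nash := (nash_equilibrium alpha beta1 beta2 mu Lambda).

(** The cost paid by every drop in equilibrium; the social cost is [Lambda] times
   this value. *)
Definition equilibrium_cost : R :=
  beta1 * beta2 * Lambda / ((beta1 + beta2) * mu).

(** The volume served by time t when the server works at full rate between the
   first and the last arrival, and at no other time. *)
Definition busy_served (t : R) : R := mu * (clamp t_first t_last t - t_first).

Lemma drop_cost_ltr t x y : x < y -> cost t x < cost t y.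
Proof.
move=> xy; rewrite /drop_cost.
have : beta2 * Num.max x 0 <= beta2 * Num.max y 0.
  by rewrite ler_pM2l// ge_max !le_max (ltW xy) lexx orbT.
have : alpha * (x - t) < alpha * (y - t) by rewrite ltr_pM2l// ltrD2r.
lra.
Qed.

(** Of two drops served at the same time, the later arrival pays less. *)
Lemma drop_cost_ltl s t x : s < t -> cost t x < cost s x.
Proof.
move=> st; rewrite /drop_cost.
have : beta1 * Num.max (- t) 0 <= beta1 * Num.max (- s) 0.
  by rewrite ler_pM2l// ge_max !le_max lexx orbT lerN2 (ltW st).
have : alpha * (x - t) < alpha * (x - s) by rewrite ltr_pM2l// ltrD2l ltrN2.
lra.
Qed.

Lemma idle_cost_le0 t : t <= 0 -> cost t t = - (beta1 * t).
Proof.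
move=> t0; rewrite /drop_cost max_l ?oppr_ge0// max_r//; ring.
Qed.

Lemma idle_cost_ge0 t : 0 <= t -> cost t t = beta2 * t.
Proof.
move=> t0; rewrite /drop_cost max_r ?oppr_le0// max_l//; ring.
Qed.

(** The cost at t is strictly increasing in the queue at t. *)
Lemma arrival_cost_inj (q q' : R -> R) t : acost q t = acost q' t -> q t = q' t.
Proof.
rewrite /arrival_cost => cc; case: (ltgtP (q t) (q' t)) => // qq.
  have /(@drop_cost_ltr t) : t + q t / mu < t + q' t / mu.
    by rewrite ltrD2l ltr_pM2r ?invr_gt0.
  by rewrite cc ltxx.
have /(@drop_cost_ltr t) : t + q' t / mu < t + q t / mu.
  by rewrite ltrD2l ltr_pM2r ?invr_gt0.
by rewrite cc ltxx.
Qed.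

Lemma arrival_cost0 (q : R -> R) t : q t = 0 -> acost q t = cost t t.
Proof. by rewrite /arrival_cost => ->; rewrite mul0r addr0. Qed.

Lemma arrival_cost_gt0 (q : R -> R) t : 0 < q t -> cost t t < acost q t.
Proof. by move=> q0; apply: drop_cost_ltr; rewrite ltrDl divr_gt0. Qed.

Lemma arrival_cost_ge0 (q : R -> R) t : 0 <= q t -> cost t t <= acost q t.
Proof.
rewrite le_eqVlt => /orP[/eqP q0|/arrival_cost_gt0/ltW//].
by rewrite arrival_cost0.
Qed.

Lemma arrival_cost_continuous (q : R -> R) : continuous q -> continuous (acost q).
Proof.
move=> cq t; rewrite /arrival_cost /drop_cost.
have cleave : {for t, continuous (fun u => u + q u / mu)}.
  by apply: cvgD; [exact: cvg_id|apply: cvgM; [exact: cq|exact: cvg_cst]].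
apply: cvgD; first apply: cvgD.
- apply: cvgM; first exact: cvg_cst.
  apply: (continuous_max (f := fun u : R => - u) (g := fun=> 0)); last exact: cvg_cst.
  exact: opp_continuous.
- apply: cvgM; first exact: cvg_cst.
  by apply: cvgB; [exact: cleave|exact: cvg_id].
- apply: cvgM; first exact: cvg_cst.
  apply: (continuous_max (f := fun u : R => u + q u / mu) (g := fun=> 0)) => //.
  exact: cvg_cst.
Qed.

(** * The structure of an equilibrium *)

Lemma fluid_queue_continuous (P : probability (measurableTypeR R) R) (q : R -> R) :
  atomless P -> fluid_queue mu Lambda P q -> continuous q.
Proof.
move=> atP [_ Slip _].
have -> : q = (fun u => Lambda * arrived P u - served Lambda P q u).
  by apply/funext => u; rewrite /served; ring.
move=> u; apply: cvgB.
  by apply: cvgM; [exact: cvg_cst|exact: (arrived_continuous atP)].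
apply/cvgrPdist_le => e e0; near=> v.
have : `|u - v| <= e / mu.
  near: v; apply/nbhs_ballP; exists (e / mu); first exact: divr_gt0.
  by move=> v /= /ltW.
rewrite ler_pdivlMr// mulrC.
case: (leP u v) => [uv|/ltW vu].
  have /andP[+ h2] := Slip _ _ uv; rewrite subr_ge0 => h1.
  by rewrite distrC (distrC (served _ _ _ u)) !ger0_norm ?subr_ge0// => /(le_trans h2).
have /andP[+ h2] := Slip _ _ vu; rewrite subr_ge0 => h1.
by rewrite !ger0_norm ?subr_ge0// => /(le_trans h2).
Unshelve. all: by end_near. Qed.

(** The properties shared by all equilibria, on which uniqueness rests. *)
Lemma nash_structure (P : probability (measurableTypeR R) R) (q : R -> R) :
  nash P q ->
  (forall t, served Lambda P q t = busy_served t) /\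
  (forall t, acost q t = Num.max equilibrium_cost (cost t t)).
Proof.
case=> atP [qA Slip Sbusy] [c [Cc Cge]].
set S := served Lambda P q in Slip Sbusy *.
have AE t : Lambda * arrived P t = S t + q t by rewrite /S /served subrK.
have q0 t : 0 <= q t by case/andP: (qA t).
have CV t := arrival_cost_ge0 (q0 t).
have c0 : 0 < c.
  have [t /Cc <- t0] := support_neq_exists atP 0.
  apply: lt_le_trans (CV t); case: (ltgtP t 0) t0 => // t0 _.
    by rewrite idle_cost_le0 ?ltW// -mulrN mulr_gt0// oppr_gt0.
  by rewrite idle_cost_ge0 ?ltW// mulr_gt0.
pose a := - (c / beta1); pose b := c / beta2.
have aE : beta1 * a = - c by rewrite /a; field; exact: lt0r_neq0.
have bE : beta2 * b = c by rewrite /b; field; exact: lt0r_neq0.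
have a0 : a < 0 by rewrite oppr_lt0 divr_gt0.
have b0 : 0 < b by rewrite divr_gt0.
have Va t : t <= 0 -> cost t t = c + beta1 * (a - t).
  by move=> t0; rewrite idle_cost_le0//; lra.
have Vb t : 0 <= t -> cost t t = c + beta2 * (t - b).
  by move=> t0; rewrite idle_cost_ge0//; lra.
have Vlt t : a < t < b -> cost t t < c.
  move=> /andP[at_ tb]; case: (leP t 0) => t0.
    by rewrite Va// gtrDl pmulr_rlt0// subr_lt0.
  by rewrite Vb ?ltW// gtrDl pmulr_rlt0// subr_lt0.
have Vgta t : t < a -> c < cost t t.
  by move=> ta; rewrite Va ?ltrDl ?mulr_gt0 ?subr_gt0// (le_trans (ltW ta)) ?ltW.
have Vgtb t : b < t -> c < cost t t.
  by move=> bt; rewrite Vb ?ltrDl ?mulr_gt0 ?subr_gt0// (le_trans _ (ltW bt)) ?ltW.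
have suppa t : t < a -> ~ arrival_support P t.
  by move=> /Vgta ct /Cc Ct; have := CV t; rewrite Ct leNgt ct.
have suppb t : b < t -> ~ arrival_support P t.
  by move=> /Vgtb ct /Cc Ct; have := CV t; rewrite Ct leNgt ct.
have Aa t : t <= a -> arrived P t = 0.
  by move=> ta; apply: arrived_eq0 => u ut; apply: suppa; exact: lt_le_trans ta.
have Ab t : b <= t -> arrived P t = 1.
  by move=> bt; apply: arrived_eq1 => // u tu; apply: suppb; exact: le_lt_trans tu.
have qa t : t <= a -> q t = 0.
  move=> ta; have := qA t; rewrite Aa// mulr0 => qt; lra.
have Sa t : t <= a -> S t = 0.
  by move=> ta; have := AE t; rewrite Aa// qa//; lra.
have qgt0 t : a < t < b -> 0 < q t.
  move=> /Vlt Vc; rewrite lt_neqAle q0 andbT; apply/eqP => /esym/arrival_cost0 Ct.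
  by have := Cge t; rewrite Ct leNgt Vc.
(* The server is busy strictly inside the interval, so the full rate holds from
   a + d to t - d; the rate bound controls the two ends as d tends to 0. *)
have Sab t : a <= t <= b -> S t = mu * (t - a).
  case/andP; rewrite le_eqVlt => /orP[/eqP <- _|at_ tb]; first by rewrite Sa// subrr mulr0.
  have /andP[_ up] := Slip _ _ (ltW at_); rewrite (Sa a)// subr0 in up.
  apply/eqP; rewrite eq_le up /=; apply/ler_addgt0Pr => e e0.
  pose d := Num.min ((t - a) / 3) (e / (2 * mu)).
  have d0 : 0 < d by rewrite lt_min !divr_gt0 ?mulr_gt0//; lra.
  have d1 : 3 * d <= t - a by rewrite mulrC -ler_pdivlMr// ge_min lexx.
  have d2 : 2 * mu * d <= e by rewrite mulrC -ler_pdivlMr ?mulr_gt0// ge_min lexx orbT.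
  have /Sbusy mid : a + d <= t - d by lra.
  have /mid {}mid : forall u, a + d <= u <= t - d -> 0 < q u.
    by move=> u /andP[u1 u2]; apply: qgt0; lra.
  have /Slip/andP[lo _] : a <= a + d by lra.
  have /Slip/andP[hi _] : t - d <= t by lra.
  rewrite (Sa a)// in lo; lra.
(* Otherwise, with s the last time before t where the cost is c, drops arriving
   at s and at t would be served at the same time. *)
have Cab t : a <= t <= b -> acost q t = c.
  move=> /andP[at_ tb]; apply/eqP; rewrite eq_le Cge andbT leNgt; apply/negP => ct.
  pose E := [set u | a <= u <= t /\ acost q u = c].
  have Ea : E a.
    by split; rewrite ?lexx// arrival_cost0 ?qa// Va ?ltW// subrr mulr0 addr0.
  have supE : has_sup E.
    by split; [exists a | exists t => u [/andP[]]].
  pose s := sup E.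
  have sa : a <= s by apply: sup_upper_bound.
  have st : s <= t by apply: sup_le_ub; [exists a|move=> u [/andP[]]].
  have cC := arrival_cost_continuous (fluid_queue_continuous atP (And3 qA Slip Sbusy)).
  have Cs : acost q s = c.
    have : closure [set u | acost q u = c] s.
      apply: closure_subset (closure_sup _ _); last exact: supE.2.
        by move=> u [].
      by exists a.
    apply: (preimage_closed (f := acost q) (D := [set c])); last exact: closed_eq.
    by move=> u _; exact: cC.
  have {}st : s < t by rewrite lt_neqAle st andbT; apply/eqP => E1; rewrite -E1 Cs ltxx in ct.
  have As : arrived P s = arrived P t.
    apply: arrived_off_support => //; first exact: ltW.
    move=> u /andP[su ut] /Cc Cu.
    have : u <= s by apply: sup_upper_bound => //; split => //; lra.
    lra.
  have Ss : S t - S s = mu * (t - s).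
    rewrite (Sab t) ?at_// (Sab s) ?sa/=; [ring | exact: le_trans (ltW st) tb].
  have qst : q t = q s - mu * (t - s).
    have := AE s; have := AE t; rewrite As; lra.
  have := drop_cost_ltl (t + q t / mu) st.
  have e1 : t + q t / mu = s + q s / mu.
    by rewrite qst; field; exact: lt0r_neq0.
  move: ct Cs; rewrite /arrival_cost e1 => + ->; lra.
(* At b the cost c is already the idle cost, which leaves no room for a queue. *)
have qb : q b = 0.
  apply/eqP; rewrite eq_le q0 andbT leNgt; apply/negP => /arrival_cost_gt0.
  rewrite Cab ?lexx ?andbT; last lra.
  by rewrite Vb ?ltW// subrr mulr0 addr0 ltxx.
have Lab : Lambda = mu * (b - a).
  by rewrite -Sab ?lexx ?andbT; [have := AE b; rewrite Ab// qb; lra | lra].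
have bb : 0 < beta1 + beta2 by exact: addr_gt0.
have cE : equilibrium_cost = c.
  rewrite /equilibrium_cost Lab /a /b; field.
  by rewrite !lt0r_neq0.
have fE : t_first = a.
  rewrite /first_arrival /a -cE /equilibrium_cost; field.
  by rewrite !lt0r_neq0.
have lE : t_last = b.
  rewrite /last_arrival /b -cE /equilibrium_cost; field.
  by rewrite !lt0r_neq0.
have Sb t : b <= t -> S t = Lambda /\ q t = 0.
  move=> bt; have /andP[h _] := Slip _ _ bt.
  have := AE t; rewrite Ab//; have := q0 t; have : S b = Lambda.
    by rewrite Sab ?lexx ?andbT; lra.
  by split; lra.
rewrite /busy_served /clamp cE fE lE; split => t.
- case: (leP t a) => ta.
    by rewrite Sa// min_l ?max_l ?subrr ?mulr0//; lra.
  case: (leP t b) => tb.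
    by rewrite max_r ?Sab//; lra.
  by rewrite max_r; [have [-> _] := Sb t (ltW tb) | lra].
- case: (ltP t a) => ta.
    by rewrite arrival_cost0 ?max_r ?qa ?ltW// Vgta.
  case: (leP t b) => tb.
    rewrite Cab ?max_l//; last lra.
    case: (ltP t b) => tb'; last first.
      have -> : t = b by lra.
      by rewrite (Vb b (ltW b0)) subrr mulr0 addr0.
    case: (ltP a t) => ta'; first by rewrite ltW// Vlt// ta'.
    have -> : t = a by lra.
    by rewrite (Va a (ltW a0)) subrr mulr0 addr0.
  rewrite arrival_cost0; last by have [] := Sb t (ltW tb).
  by rewrite max_r// ltW// Vgtb.
Qed.

(** * The queue of the step density *)

Local Notation c_eq := equilibrium_cost.

(** The three values of the step density, in order of time. *)
Definition step1 := (alpha + beta1) / alpha * (mu / Lambda).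
Definition step2 := (alpha + beta1) / (alpha + beta2) * (mu / Lambda).
Definition step3 := alpha / (alpha + beta2) * (mu / Lambda).

(** The distribution function of the step density. *)
Definition step_cdf (t : R) : R :=
  step1 * (clamp t_first t_switch t - t_first) + step2 * (clamp t_switch 0 t - t_switch)
  + step3 * (clamp 0 t_last t - 0).

(** The queue under the step density: what has arrived minus what has been served
   by a server that is never idle between the first and the last arrival. *)
Definition step_queue (t : R) : R := Lambda * step_cdf t - busy_served t.

Lemma step_gt0 : [/\ 0 < step1, 0 < step2 & 0 < step3].
Proof. by split; rewrite /step1 /step2 /step3 mulr_gt0 ?divr_gt0 ?addr_gt0. Qed.

Lemma equilibrium_cost_gt0 : 0 < c_eq.
Proof. by rewrite /equilibrium_cost divr_gt0 ?mulr_gt0 ?addr_gt0. Qed.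

Lemma first_arrivalE : t_first = - (c_eq / beta1).
Proof.
rewrite /first_arrival /equilibrium_cost; field.
by rewrite !lt0r_neq0 ?addr_gt0.
Qed.

Lemma last_arrivalE : t_last = c_eq / beta2.
Proof.
rewrite /last_arrival /equilibrium_cost; field.
by rewrite !lt0r_neq0 ?addr_gt0.
Qed.

Lemma switch_timeE : t_switch = - (c_eq / (alpha + beta1)).
Proof.
rewrite /switch_time /equilibrium_cost; field.
by rewrite !lt0r_neq0 ?addr_gt0.
Qed.

Lemma idle_cost_first : beta1 * t_first = - c_eq.
Proof. by rewrite first_arrivalE; field; exact: lt0r_neq0. Qed.

Lemma idle_cost_last : beta2 * t_last = c_eq.
Proof. by rewrite last_arrivalE; field; exact: lt0r_neq0. Qed.

Lemma volumeE : Lambda = mu * (c_eq / beta1 + c_eq / beta2).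
Proof.
rewrite /equilibrium_cost; field.
by rewrite !lt0r_neq0 ?addr_gt0.
Qed.

Lemma arrival_times_order : t_first < t_switch < 0 /\ 0 < t_last.
Proof.
have c0 := equilibrium_cost_gt0.
have ab1 := addr_gt0 halpha hbeta1.
rewrite first_arrivalE last_arrivalE switch_timeE oppr_lt0.
rewrite (divr_gt0 c0 hbeta2) (divr_gt0 c0 ab1) andbT; split => //.
by rewrite ltrN2 ltr_pM2l// ltf_pV2 ?posrE// ltrDr.
Qed.

(** The waiting time on each of the five intervals cut out by the breakpoints.
   Between the first and the last arrival it is the solution w of the equation
   [drop_cost t (t + w) = c_eq]. *)
Lemma step_queueE t :
  [\/ t <= t_first /\ step_queue t = 0,
      t_first <= t <= t_switch /\ step_queue t / mu = (c_eq + beta1 * t) / alpha |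
   [\/ t_switch <= t <= 0 /\ step_queue t / mu = (c_eq + beta1 * t - beta2 * t) / (alpha + beta2),
       0 <= t <= t_last /\ step_queue t / mu = (c_eq - beta2 * t) / (alpha + beta2) |
       t_last <= t /\ step_queue t = 0]].
Proof.
have [/andP[fs s0] l0] := arrival_times_order.
have := halpha; have := hbeta1; have := hbeta2; have := hmu; have := hLambda.
move=> /lt0r_neq0 L0 /lt0r_neq0 m0 /lt0r_neq0 b20 /lt0r_neq0 b10 /lt0r_neq0 a0.
have ab1 := lt0r_neq0 (addr_gt0 halpha hbeta1).
have ab2 := lt0r_neq0 (addr_gt0 halpha hbeta2).
have LS u : Lambda * step_cdf u =
   (alpha + beta1) / alpha * mu * (clamp t_first t_switch u - t_first)
   + (alpha + beta1) / (alpha + beta2) * mu * (clamp t_switch 0 u - t_switch)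
   + alpha / (alpha + beta2) * mu * clamp 0 t_last u.
  by rewrite /step_cdf /step1 /step2 /step3 subr0; field; rewrite L0 a0 ab2.
rewrite /step_queue /busy_served LS.
have fl : t_first <= t_last by lra.
case: (leP t t_first) => [tf|ft].
  by apply: Or31; rewrite !clamp_le; try lra; split => //; ring.
case: (leP t t_switch) => [ts|st].
  apply: Or32; rewrite (@clamp_mid _ t_first t_switch); last lra.
  rewrite (@clamp_mid _ t_first t_last) ?(@clamp_le _ t_switch 0) ?(@clamp_le _ 0 t_last); try lra.
  split; first by lra.
  by rewrite first_arrivalE; field; rewrite ?a0 ?b10 ?m0 ?ab2.
apply: Or33.
case: (leP t 0) => [t0|t0].
  apply: Or31; rewrite (@clamp_mid _ t_switch 0); last lra.
  rewrite (@clamp_mid _ t_first t_last) ?(@clamp_ge _ t_first t_switch)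
    ?(@clamp_le _ 0 t_last); try lra.
  split; first by lra.
  by rewrite first_arrivalE switch_timeE; field; rewrite ?a0 ?b10 ?m0 ?ab2 ?ab1.
case: (leP t t_last) => [tl|lt].
  apply: Or32; rewrite (@clamp_mid _ 0 t_last); last lra.
  rewrite (@clamp_mid _ t_first t_last) ?(@clamp_ge _ t_first t_switch)
    ?(@clamp_ge _ t_switch 0); try lra.
  split; first by lra.
  by rewrite first_arrivalE switch_timeE; field; rewrite ?a0 ?b10 ?m0 ?ab2 ?ab1.
apply: Or33; rewrite !clamp_ge; try lra; split; first exact: ltW.
by rewrite first_arrivalE switch_timeE last_arrivalE; field; rewrite ?a0 ?b10 ?b20 ?m0 ?ab2 ?ab1.
Qed.

Lemma step_queue_ge0 t : 0 <= step_queue t.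
Proof.
have aE := idle_cost_first; have bE := idle_cost_last.
have sE : (alpha + beta1) * t_switch = - c_eq.
  by rewrite switch_timeE; field; rewrite lt0r_neq0 ?addr_gt0.
have ab2 : 0 < alpha + beta2 by exact: addr_gt0.
suff pos : 0 <= step_queue t / mu by rewrite -(pmulr_lge0 _ (_ : 0 < mu^-1)) ?invr_gt0.
have m1 x y : x <= y -> beta1 * x <= beta1 * y by rewrite ler_pM2l.
have m2 x y : x <= y -> beta2 * x <= beta2 * y by rewrite ler_pM2l.
case: (step_queueE t) => [[_ ->]|[/andP[h1 h2] ->]|[[/andP[h1 h2] ->]|[/andP[h1 h2] ->]|[_ ->]]];
  rewrite ?mul0r// divr_ge0 ?(ltW ab2) ?(ltW halpha)//.
- by have := m1 _ _ h1; lra.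
- have : 0 <= alpha * - t_switch by rewrite mulr_ge0 ?ltW//; have [] := arrival_times_order; lra.
  by have := m1 _ _ h1; have := m2 _ _ h2; lra.
- by have := m2 _ _ h2; lra.
Qed.

Lemma step_queue_cost t : acost step_queue t = Num.max c_eq (cost t t).
Proof.
have aE := idle_cost_first; have bE := idle_cost_last.
have sE : (alpha + beta1) * t_switch = - c_eq.
  by rewrite switch_timeE; field; rewrite lt0r_neq0 ?addr_gt0.
have [/andP[fs s0] l0] := arrival_times_order.
have ab2 : 0 < alpha + beta2 by exact: addr_gt0.
have ab1 : 0 < alpha + beta1 by exact: addr_gt0.
have m1 x y : x <= y -> beta1 * x <= beta1 * y by rewrite ler_pM2l.
have m2 x y : x <= y -> beta2 * x <= beta2 * y by rewrite ler_pM2l.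
have m12 x y : x <= y -> (alpha + beta1) * x <= (alpha + beta1) * y by rewrite ler_pM2l.
have a0 := lt0r_neq0 halpha; have ab20 := lt0r_neq0 ab2.
case: (step_queueE t) => [[h1 q0]|[/andP[h1 h2] q0]|[[/andP[h1 h2] q0]|[/andP[h1 h2] q0]|[h1 q0]]].
- rewrite arrival_cost0// max_r// idle_cost_le0; last lra.
  by have := m1 _ _ h1; lra.
- rewrite max_l; last by rewrite idle_cost_le0; have := m1 _ _ h1; lra.
  rewrite /arrival_cost q0 /drop_cost max_l; last lra.
  rewrite max_r; first by field.
  have -> : t + (c_eq + beta1 * t) / alpha = ((alpha + beta1) * t + c_eq) / alpha by field.
  by rewrite ler_pdivrMr// mul0r; have := m12 _ _ h2; lra.
- rewrite max_l; last first.
    by rewrite idle_cost_le0//; have := m1 _ _ (ltW fs); have := m1 _ _ h1; lra.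
  rewrite /arrival_cost q0 /drop_cost max_l; last lra.
  rewrite max_l; first by field.
  have -> : t + (c_eq + beta1 * t - beta2 * t) / (alpha + beta2)
    = ((alpha + beta1) * t + c_eq) / (alpha + beta2) by field.
  by rewrite divr_ge0 ?(ltW ab2)//; have := m12 _ _ h1; lra.
- rewrite max_l; last by rewrite idle_cost_ge0//; have := m2 _ _ h2; lra.
  rewrite /arrival_cost q0 /drop_cost max_r; last lra.
  rewrite max_l; first by field.
  by rewrite addr_ge0// divr_ge0 ?(ltW ab2)//; have := m2 _ _ h2; lra.
- rewrite arrival_cost0// max_r// idle_cost_ge0; last lra.
  by have := m2 _ _ h1; lra.
Qed.

(** A queue makes the cost exceed the idle cost, so the idle cost is below
   [c_eq]. *)
Lemma step_queue_gt0 t : 0 < step_queue t -> t_first < t < t_last.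
Proof.
have aE := idle_cost_first; have bE := idle_cost_last.
have [/andP[fs s0] l0] := arrival_times_order.
move=> q0; have := arrival_cost_gt0 q0.
rewrite step_queue_cost lt_max ltxx orbF => Vc.
rewrite !ltNge; apply/andP; split; apply/negP => h; move: Vc.
  rewrite idle_cost_le0; last lra.
  have : beta1 * t <= beta1 * t_first by rewrite ler_pM2l.
  lra.
rewrite idle_cost_ge0; last lra.
have : beta2 * t_last <= beta2 * t by rewrite ler_pM2l.
lra.
Qed.

(** * Existence and uniqueness *)

Lemma step_densityE t :
  step t = step1 * \1_(`[t_first, t_switch]%classic) t + step2 * \1_(`]t_switch, 0]%classic) t
           + step3 * \1_(`]0, t_last]%classic) t.
Proof.
have [/andP[fs s0] l0] := arrival_times_order.
rewrite !indicE !mem_setE !in_itv /= /step_density -/step1 -/step2 -/step3.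
case: (ltP t t_first) => tf /=.
  have -> : (t_switch <= t) = false by lra.
  have -> : (t_switch < t) = false by lra.
  have -> : (0 < t) = false by lra.
  have -> : (0 <= t) = false by lra.
  by rewrite !mulr0 !addr0.
case: (leP t t_switch) => ts /=.
  have -> : (0 < t) = false by lra.
  by rewrite mulr1 !mulr0 !addr0.
rewrite (ltW ts) /=; case: (leP t 0) => t0 /=.
  by rewrite mulr1 !mulr0 addr0 add0r.
rewrite (ltW t0) /=; case: (leP t t_last) => tl /=.
  by rewrite mulr1 !mulr0 !add0r.
by rewrite !mulr0 !addr0.
Qed.

Lemma measurable_step : measurable_fun setT step.
Proof.
rewrite (funext step_densityE).
apply: measurable_funD; first apply: measurable_funD;
  by apply: measurable_funM => //; apply: measurable_indic.
Qed.

Lemma step_ge0 t : 0 <= step t.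
Proof.
have [k1 k2 k3] := step_gt0.
by rewrite step_densityE !addr_ge0// mulr_ge0// ltW.
Qed.

Lemma integral_step (A : set (measurableTypeR R)) : measurable A ->
  (\int[lebesgue_measure]_(t in A) (step t)%:E =
   step1%:E * lebesgue_measure (`[t_first, t_switch]%classic `&` A) +
   step2%:E * lebesgue_measure (`]t_switch, 0%R]%classic `&` A) +
   step3%:E * lebesgue_measure (`]0%R, t_last]%classic `&` A))%E.
Proof.
move=> mA; have [k1 k2 k3] := step_gt0.
have mI (B : set R) : measurable B -> measurable_fun A (fun t => (\1_B t)%:E : \bar R).
  by move=> mB; apply/measurable_EFinP; exact: measurable_indic.
have mKI k (B : set R) : measurable B -> measurable_fun A (fun t => (k%:E * (\1_B t)%:E)%E : \bar R).
  by move=> mB; apply: measurable_funeM; exact: mI.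
have KI0 k (B : set R) t : 0 < k -> (0 <= k%:E * (\1_B t)%:E)%E.
  by move=> k0; rewrite mule_ge0// lee_fin// ltW.
have int1 k (B : set R) : 0 < k -> measurable B ->
    (\int[lebesgue_measure]_(t in A) (k%:E * (\1_B t)%:E) = k%:E * lebesgue_measure (B `&` A))%E.
  move=> k0 mB; rewrite ge0_integralZl//; last by rewrite lee_fin ltW.
  - by rewrite integral_indic.
  - exact: mI.
under eq_integral do rewrite step_densityE !EFinD !EFinM.
rewrite ge0_integralD//=.
- rewrite ge0_integralD//=; [by rewrite !int1| | | |].
  + by move=> t _; exact: KI0.
  + exact: mKI.
  + by move=> t _; exact: KI0.
  + exact: mKI.
- by move=> t _; rewrite adde_ge0// KI0.
- by apply: emeasurable_funD; exact: mKI.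
- by move=> t _; exact: KI0.
- exact: mKI.
Qed.

Lemma integral_step_ray (t : R) :
  (\int[lebesgue_measure]_(u in `]-oo, t[) (step u)%:E =
   (step_cdf t)%:E)%E.
Proof.
have [/andP[fs s0] l0] := arrival_times_order.
by rewrite integral_step//= !lebesgue_measure_itv_clamp ?ltW// -!EFinM -!EFinD.
Qed.

(** The queue is empty from the last arrival on, so the arrived volume is the
   served one, mu * (t_last - t_first) = Lambda. *)
Lemma step_cdf_last t : t_last <= t -> step_cdf t = 1.
Proof.
have [/andP[fs s0] l0] := arrival_times_order.
move=> lt; have q0 : step_queue t = 0.
  apply/eqP; rewrite eq_le step_queue_ge0// andbT leNgt; apply/negP.
  by move=> qt; have := step_queue_gt0 qt; rewrite (ltNge t) lt andbF.
have busyE : busy_served t = Lambda.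
  rewrite /busy_served clamp_ge//; last lra.
  rewrite first_arrivalE last_arrivalE opprK [_ + _]addrC.
  by rewrite [RHS]volumeE.
apply: (mulfI (lt0r_neq0 hLambda)); rewrite mulr1 -[RHS]busyE.
by apply/eqP; rewrite -subr_eq0; apply/eqP.
Qed.

Lemma integral_step_total : (\int[lebesgue_measure]_t (step t)%:E = 1)%E.
Proof.
rewrite -(@step_cdf_last (t_last + 1)) ?lerDl// -integral_step_ray.
rewrite !integral_step//= !setIT.
have [/andP[fs s0] l0] := arrival_times_order.
have sub b x y : y <= t_last ->
    [set` Interval (BSide b x) (BRight y)] `&` `]-oo, (t_last + 1)[
    = [set` Interval (BSide b x) (BRight y)] :> set R.
  move=> yl; apply: setIidl => z /=.
  by rewrite !itv_boundlr /= !bnd_simp => /andP[_ zy]; lra.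
by rewrite !sub//; lra.
Qed.

Lemma arrived_step (P : probability (measurableTypeR R) R) :
  density_of P step -> arrived P =1 step_cdf.
Proof. by move=> [_ _ Pf] t; rewrite /arrived Pf// integral_step_ray. Qed.

Lemma step_density_exists : exists P : probability (measurableTypeR R) R, density_of P step.
Proof.
apply: probability_of_density; [exact: measurable_step|exact: step_ge0|exact: integral_step_total].
Qed.

Lemma step_nash (P : probability (measurableTypeR R) R) :
  density_of P step -> nash P step_queue.
Proof.
move=> dP; have [/andP[fs s0] l0] := arrival_times_order.
have SE t : served Lambda P step_queue t = mu * (clamp t_first t_last t - t_first).
  by rewrite /served (arrived_step dP) /step_queue opprB addrC subrK.
have fl : t_first <= t_last by lra.
split; first exact: density_atomless dP.
- split.
  + move=> t; rewrite step_queue_ge0//= -subr_ge0 -/(served _ _ _ _) SE.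
    by rewrite mulr_ge0 ?(ltW hmu)// subr_ge0 /clamp le_max lexx.
  + move=> s t st; rewrite !SE.
    have -> : mu * (clamp t_first t_last t - t_first) - mu * (clamp t_first t_last s - t_first) =
       mu * (clamp t_first t_last t - clamp t_first t_last s) by ring.
    have /andP[h1 h2] := clamp_lipschitz fl st.
    by rewrite mulr_ge0 ?(ltW hmu)// ler_pM2l.
  + move=> s t st qpos; rewrite !SE.
    have [/andP[s1 s2] /andP[t1 t2]] : t_first < s < t_last /\ t_first < t < t_last.
      by split; apply: step_queue_gt0 => //; apply: qpos; rewrite st lexx.
    rewrite (@clamp_mid _ _ _ t) ?(ltW t1) ?(ltW t2)//.
    by rewrite (@clamp_mid _ _ _ s) ?(ltW s1) ?(ltW s2)//; ring.
exists c_eq; split => t; last by rewrite step_queue_cost// le_max lexx.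
move=> St; rewrite step_queue_cost// max_l//.
have aE := idle_cost_first; have bE := idle_cost_last.
(* There are points of positive density arbitrarily close to t. *)
have tI : t_first <= t <= t_last.
  rewrite !leNgt; apply/andP; split; apply/negP => h.
    have e0 : 0 < t_first - t by rewrite subr_gt0.
    have [u] := density_neq0_near_support dP St e0.
    rewrite in_ball step_densityE !indicE !mem_setE !in_itv /= => /andP[_ u1].
    have -> : (t_first <= u) = false by lra.
    have -> : (t_switch < u) = false by lra.
    have -> : (0 < u) = false by lra.
    by rewrite !mulr0 !addr0 eqxx.
  have e0 : 0 < t - t_last by rewrite subr_gt0.
  have [u] := density_neq0_near_support dP St e0.
  rewrite in_ball step_densityE !indicE !mem_setE !in_itv /= => /andP[u1 _].
  have -> : (u <= t_last) = false by lra.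
  have -> : (u <= 0) = false by lra.
  have -> : (u <= t_switch) = false by lra.
  by rewrite !andbF !mulr0 !addr0 eqxx.
case/andP: tI => t1 t2; case: (leP t 0) => t0.
  rewrite idle_cost_le0//; have : beta1 * t_first <= beta1 * t by rewrite ler_pM2l.
  lra.
rewrite idle_cost_ge0 ?(ltW t0)//; have : beta2 * t <= beta2 * t_last by rewrite ler_pM2l.
lra.
Qed.

Lemma step_continuous t : t \notin [:: t_first; t_switch; 0; t_last] -> {for t, continuous step}.
Proof.
rewrite !inE !negb_or => /and4P[tf ts t0 tl].
rewrite (funext step_densityE).
by apply: cvgD; first apply: cvgD; apply: cvgM; try exact: cvg_cst; exact: continuous_indic_itv.
Qed.

Lemma nash_density (P : probability (measurableTypeR R) R) q : nash P q -> density_of P step.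
Proof.
move=> N; have [SE CE] := nash_structure N.
have qE t : q t = step_queue t.
  apply: arrival_cost_inj; by rewrite CE step_queue_cost.
have [P0 dP0] := step_density_exists.
have PP0 : arrived P =1 arrived P0.
  move=> t; rewrite (arrived_step dP0).
  apply: (mulfI (lt0r_neq0 hLambda)); have := SE t.
  by rewrite /served qE /step_queue => /eqP; rewrite subr_eq => /eqP ->; ring.
case: (dP0) => mf f0 Pf; split => // A mA.
by rewrite (arrived_determines PP0)// Pf.
Qed.

Lemma nash_social_cost (P : probability (measurableTypeR R) R) q : nash P q ->
  social_cost alpha beta1 beta2 mu Lambda P q = (Lambda * c_eq)%:E.
Proof.
move=> N; have [SE CE] := nash_structure N.
have c0 := equilibrium_cost_gt0.
case: N => _ _ [c' [Cc' C'le]].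
(* The common cost is at most the cost c_eq of arriving at 0. *)
have c'E t : arrival_support P t -> acost q t = c_eq.
  move=> St; apply/eqP; rewrite eq_le {2}CE le_max lexx andbT (Cc' _ St).
  by have := C'le 0; rewrite CE (idle_cost_ge0 (lexx 0)) mulr0 max_l ?(ltW c0).
(* The idle cost is the cost for an empty queue, hence continuous. *)
have V0 t : acost (fun=> 0) t = cost t t by exact: arrival_cost0.
have cC : continuous (acost q).
  move=> t; have cV := @arrival_cost_continuous (fun=> 0) (fun u => cvg_cst _).
  have -> : acost q = (fun=> c_eq) \max acost (fun=> 0).
    by apply/funext => u; rewrite CE -V0.
  by apply: continuous_max; [exact: cvg_cst|exact: cV].
have mC : measurable_fun (setT : set (measurableTypeR R)) (acost q : measurableTypeR R -> R).
  exact: continuous_measurable_fun.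
rewrite /social_cost (ae_eq_integral (cst c_eq%:E))//=.
- by rewrite integral_cst// [X in (_ * (_ * X))%E]probability_setT mule1 -EFinM.
- exact/measurable_EFinP.
- apply: negligibleS (complement_support_negligible P) => t /= h St.
  by apply: h => _; rewrite c'E.
Qed.

End Equilibria.

Theorem theorem2 (R : realType) (alpha beta1 beta2 mu Lambda : R)
    (halpha : 0 < alpha) (hbeta1 : 0 < beta1) (hbeta2 : 0 < beta2)
    (hmu : 0 < mu) (hLambda : 0 < Lambda) :
  (exists (P : probability (measurableTypeR R) R) (q : R -> R),
     nash_equilibrium alpha beta1 beta2 mu Lambda P q) /\
  (forall (P : probability (measurableTypeR R) R) (q : R -> R),
     nash_equilibrium alpha beta1 beta2 mu Lambda P q ->
     [/\ density_of P (step_density alpha beta1 beta2 mu Lambda),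
         forall f : R -> R, density_of P f ->
           f = step_density alpha beta1 beta2 mu Lambda
             %[ae (@lebesgue_measure R)],
         forall f : R -> R, density_of P f -> piecewise_continuous f ->
           finite_set
             [set t | f t <> step_density alpha beta1 beta2 mu Lambda t]
       & social_cost alpha beta1 beta2 mu Lambda P q
         = (beta1 * beta2 * Lambda ^+ 2 / ((beta1 + beta2) * mu))%:E]).
Proof.
split.
  have [P dP] := step_density_exists halpha hbeta1 hbeta2 hmu hLambda.
  by exists P, (step_queue alpha beta1 beta2 mu Lambda); exact: step_nash.
move=> P q N; have dP := nash_density halpha hbeta1 hbeta2 hmu hLambda N.
split => //.
- by move=> f df; exact: density_ae_unique df dP.
- move=> f df pcf.
  have fs := density_ae_unique df dP.
  (* Off the discontinuities of f and the breakpoints of the step density, the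
     two continuous functions agree almost everywhere, hence at the point. *)
  pose E := [:: first_arrival beta1 beta2 mu Lambda; switch_time alpha beta1 beta2 mu Lambda; 0;
                last_arrival beta1 beta2 mu Lambda].
  apply: (@sub_finite_set _ _ ([set t | ~ {for t, continuous f}] `|` [set` E])).
    move=> t /= ne; apply: contrapT => /not_orP[/contrapT cf /negP tE].
    apply: ne; apply: ae_eq_at_continuity => //.
    exact: (step_continuous halpha hbeta1 hbeta2 hmu hLambda).
  by rewrite finite_setU; split => //; exact: finite_seq.
- rewrite (nash_social_cost halpha hbeta1 hbeta2 hmu hLambda N); congr EFin.
  by rewrite /equilibrium_cost expr2; ring.
Qed.
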